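(* Let $([n],\phi)$ be an $n$-component semicoherent system with continuous i.i.d. component lifetimes, let $h(x)$ be the diagonal section of its reliability function, let $h^R(x)=x^n h(1/x)$ be the $n$-reflected polynomial of $h(x)$, and let $(\overline{S}_0,\ldots,\overline{S}_n)$ be the tail signature of the system. Then $$h^R(x)=\sum_{k=0}^n \binom{n}{k}\,\overline{S}_k\,(x-1)^k .$$ Thus, for every $k\in\{0,\ldots,n\}$, the number $\binom{n}{k}\overline{S}_k$ is precisely the coefficient of $(x-1)^k$ in the Taylor expansion about $x=1$ of the $n$-reflected diagonal section of the reliability function $h$.
   Context: Let $[n]=\{1,\ldots,n\}$. An $n$-component system $([n],\phi)$ has a structure function $\phi\colon\{0,1\}^n\to\{0,1\}$; subsets $A\subseteq[n]$ are identified with Boolean vectors $\mathbf{x}\in\{0,1\}^n$ via $x_i=1$ iff $i\in A$, so one writes $\phi(A)$. The system is semicoherent if $\phi$ is nondecreasing in each variable, $\phi(0,\ldots,0)=0$ and $\phi(1,\ldots,1)=1$. The components have lifetimes $T_1,\ldots,T_n$, which are i.i.d. with a continuous distribution; $T_S$ is the system lifetime (the system works at time $t$ iff $\phi(\{i: T_i>t\})=1$), and $T_{k:n}$ is the $k$th smallest of $T_1,\ldots,T_n$. The signature is $\mathbf{s}=(s_1,\ldots,s_n)$ with $s_k=\Pr(T_S=T_{k:n})$. The tail signature is $(\overline{S}_0,\ldots,\overline{S}_n)$ with $$\overline{S}_k=\sum_{i=k+1}^n s_i=\frac{1}{\binom{n}{n-k}}\sum_{A\subseteq[n],\,|A|=n-k}\phi(A),$$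 the second equality being Boland's known formula. The reliability function $h\colon[0,1]^n\to\mathbb{R}$ of $\phi$ is its multilinear extension: the unique polynomial function $h(\mathbf{x})=\sum_{A\subseteq[n]}c(A)\prod_{i\in A}x_i$ of degree at most one in each variable that agrees with $\phi$ on $\{0,1\}^n$, i.e. $c(A)=\sum_{B\subseteq A}(-1)^{|A|-|B|}\phi(B)$. Its diagonal section is the univariate polynomial $h(x)=h(x,\ldots,x)$. For a univariate polynomial $f(x)=a_nx^n+\cdots+a_1x+a_0$ of degree at most $n$, its $n$-reflected polynomial is $f^R(x)=a_0x^n+a_1x^{n-1}+\cdots+a_n$, equivalently $f^R(x)=x^nf(1/x)$. *)

(* Defs.v *)
From HB Require Import structures.
From mathcomp Require Import all_boot all_order all_algebra.
From mathcomp Require Import all_classical all_reals all_analysis.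

Set Implicit Arguments.
Unset Strict Implicit.
Unset Printing Implicit Defensive.

Import Order.TTheory GRing.Theory Num.Theory.
Import numFieldNormedType.Exports.

Local Open Scope classical_set_scope.
Local Open Scope ring_scope.

(* Components are indexed by 'I_n = {0, ..., n-1} instead of {1, ..., n}, and a
   Boolean vector x is identified with the set {i | x_i = 1}, so that a
   structure function {0,1}^n -> {0,1} is a map {set 'I_n} -> bool. *)
Definition structure_function (n : nat) := {set 'I_n} -> bool.

Definition semicoherent (n : nat) (phi : structure_function n) : Prop :=
  [/\ forall (A : {set 'I_n}) (i : 'I_n), phi A -> phi (i |: A)%SET,
      ~~ phi finset.set0 & phi [set: 'I_n]%SET].

Section Reliability.
Context {R : realType} {n : nat}.
Implicit Types (phi : structure_function n) (A B : {set 'I_n}).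

Definition mobius_coef phi A : R :=
  \sum_(B : {set 'I_n} | B \subset A) (-1) ^+ (#|A| - #|B|) * (phi B)%:R.

(* The multilinear extension of phi, as a polynomial function on the whole of
   R^n rather than on the cube [0,1]^n only. *)
Definition reliability phi (x : 'I_n -> R) : R :=
  \sum_(A : {set 'I_n}) mobius_coef phi A * \prod_(i in A) x i.

Definition diagonal_section phi : {poly R} :=
  \sum_(A : {set 'I_n}) mobius_coef phi A *: 'X^#|A|.

Lemma horner_diagonal_section phi (x : R) :
  (diagonal_section phi).[x] = reliability phi (fun=> x).
Proof.
rewrite horner_sum; apply: eq_bigr => A _.
by rewrite hornerZ hornerXn prodr_const.
Qed.

Lemma sum_sign_interval A B : B \subset A ->
  \sum_(C : {set 'I_n} | (B \subset C) && (C \subset A))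
     (-1) ^+ (#|C| - #|B|) = (A == B)%:R :> R.
Proof.
move=> BA; have [->|neq] := eqVneq A B.
  rewrite (big_pred1 B) ?subnn// => C.
  by rewrite /= andbC -finset.eqEsubset.
have [i iA iB] : exists2 i, i \in A & i \notin B.
  by apply/subsetPn; apply: contraNN neq => AB; rewrite finset.eqEsubset AB.
rewrite (bigID (fun C : {set 'I_n} => i \in C)) /=.
rewrite (reindex_onto (fun C => i |: C)%SET (fun C => C :\ i)%SET) /=; last first.
  by move=> C /andP[_ iC]; rewrite finset.setD1K.
rewrite -[X in _ + X]opprK -sumrN; apply/eqP; rewrite subr_eq0; apply/eqP.
apply: eq_big => [C|C /andP[/andP[/andP[BC _] _] /eqP iC]].
  rewrite finset.setU11 andbT finset.subUset finset.sub1set iA /=.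
  have [iC|iC] := boolP (i \in C).
    rewrite andbF; apply/negbTE; rewrite negb_and; apply/orP; right.
    by apply: contraTneq iC => <-; rewrite !inE eqxx.
  rewrite finset.setU1K// eqxx !andbT; congr andb.
  apply/idP/idP => [/fintype.subsetP BC|BC]; last exact: fintype.subset_trans BC (finset.subsetUr _ _).
  apply/fintype.subsetP => j jB; have := BC j jB; rewrite !inE => /orP[/eqP ji|//].
  by rewrite ji (negbTE iB) in jB.
have iC' : i \notin C by rewrite -iC !inE eqxx.
have BC' : B \subset C.
  apply/fintype.subsetP => j jB; have := fintype.subsetP BC j jB; rewrite !inE => /orP[/eqP ji|//].
  by rewrite ji (negbTE iB) in jB.
by rewrite cardsU1 iC' add1n subSn ?subset_leq_card// exprS mulN1r.
Qed.

Lemma reliability_extends phi A :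
  reliability phi (fun i => (i \in A)%:R) = (phi A)%:R.
Proof.
have prodE (C : {set 'I_n}) :
    \prod_(i in C) (i \in A)%:R = (C \subset A)%:R :> R.
  have [/fintype.subsetP CA|/subsetPn[i iC iA]] := boolP (C \subset A).
    by rewrite big1// => i /CA ->.
  by rewrite (bigD1 i)//= (negbTE iA) mul0r.
rewrite /reliability /mobius_coef.
under eq_bigr do rewrite prodE mulr_natr mulrb.
rewrite -big_mkcond /= (exchange_big_dep (fun B => B \subset A)) /=; last first.
  by move=> C B CA BC; exact: fintype.subset_trans CA.
transitivity (\sum_(B : {set 'I_n} | B \subset A) (A == B)%:R * (phi B)%:R : R).
  apply: eq_bigr => B BA; rewrite -mulr_suml.
  under eq_bigl do rewrite andbC.
  by rewrite sum_sign_interval.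
rewrite (bigD1 A)//= eqxx mul1r big1 ?addr0// => B /andP[_ /negbTE].
by rewrite eq_sym => ->; rewrite mul0r.
Qed.

End Reliability.

(* The coefficient of 'X^i is f`_(n - i); this is the n-reflected polynomial
   when f has degree at most n. *)
Definition reflected_poly (R : realType) (n : nat) (f : {poly R}) : {poly R} :=
  \poly_(i < n.+1) f`_(n - i).

Lemma horner_reflected_poly (R : realType) (n : nat) (f : {poly R}) (x : R) :
  (size f <= n.+1)%N -> x != 0 ->
  (reflected_poly n f).[x] = x ^+ n * f.[x^-1].
Proof.
move=> sf x0; rewrite horner_poly (horner_coef_wide _ sf) mulr_sumr.
rewrite (reindex_inj rev_ord_inj) /=; apply: eq_bigr => i _.
rewrite subSS subKn ?leq_ord// mulrCA; congr (_ * _).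
by rewrite exprVn -expfB_cond ?(negbTE x0) ?leq_ord.
Qed.

Section Lifetimes.
Context {R : realType} {n : nat}.
Implicit Types (phi : structure_function n) (t : 'I_n -> R).

Definition system_lifetime phi t : R :=
  sup [set u : R | phi [set i | u < t i]%SET].

(* The k-th smallest of the lifetimes, meaningful for 1 <= k <= n. *)
Definition order_statistic t (k : nat) : R :=
  nth 0 (sort <=%R [seq t i | i : 'I_n]) k.-1.

Context {d : measure_display} {Omega : measurableType d}.
Context {P : probability Omega R}.
Implicit Types T : 'I_n -> {RV P >-> R}.

Definition independent_RVs T : Prop :=
  forall (J : {set 'I_n}) (B : 'I_n -> set R),
    (forall i, i \in J -> measurable (B i)) ->
    P (\bigcap_(i in [set` J]) (T i @^-1` B i)) =
    (\prod_(i in J) P (T i @^-1` B i))%E.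

Definition identically_distributed T : Prop :=
  forall (i j : 'I_n) (B : set R), measurable B ->
    distribution P (T i) B = distribution P (T j) B.

Definition continuously_distributed T : Prop :=
  forall i : 'I_n, continuous (cdf (T i) : R -> \bar R).

Definition signature phi T (k : nat) : R :=
  fine (P [set w | system_lifetime phi (fun i => T i w) =
                   order_statistic (fun i => T i w) k]).

Definition tail_signature phi T (k : nat) : R :=
  \sum_(k.+1 <= i < n.+1) signature phi T i.

End Lifetimes.

(* Main.v *)
(* Expanding h over subsets and applying the binomial theorem to each
   inclusion-exclusion sum gives h^R(x) = sum_A phi(A) (x - 1)^(n - |A|), so the
   theorem reduces to Boland's formula.  Almost surely there are no ties, and
   then the system fails at the (k+1)-st component failure exactly when phi holds
   on the set of components surviving the first k failures and not on the set of
   those surviving the first k + 1.  Telescoping, the tail signature at k is the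
   probability that phi holds on the set of survivors of the first k failures;
   by exchangeability of the lifetimes this random set is uniform among the
   subsets of size n - k. *)
Require Import Defs.
From HB Require Import structures.
From mathcomp Require Import all_boot all_order all_algebra perm.
From mathcomp Require Import all_classical all_reals all_analysis.
From mathcomp Require Import measurable_realfun.
Import Order.TTheory GRing.Theory Num.Theory.
Import numFieldNormedType.Exports.
Local Open Scope classical_set_scope.
Local Open Scope ring_scope.

Set Implicit Arguments.
Unset Strict Implicit.
Unset Printing Implicit Defensive.

(** * Expansion of the reflected diagonal section in powers of X - 1 *)

Lemma card_le_ord (n : nat) (A : {set 'I_n}) : (#|A| <= n)%N.
Proof. by rewrite -[X in (_ <= X)%N](card_ord n) max_card. Qed.

(** Expand a product over all components whose factor is 1 + 0 on [B] and -1 + 'X off [B]. The set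
    [A] records where the first summand is chosen, and the zeros on [B] kill every [A] that does not
    contain [B]. *)
Lemma sum_supersets_sign_exp (R : realType) (n : nat) (B : {set 'I_n}) :
  \sum_(A : {set 'I_n} | B \subset A)
     (-1) ^+ (#|A| - #|B|) *: 'X^(n - #|A|)
  = ('X - 1%:P) ^+ (n - #|B|) :> {poly R}.
Proof.
have cardC' (C : {set 'I_n}) : #|[pred i | i \notin C]| = (n - #|C|)%N.
  by rewrite -[X in (X - _)%N]card_ord -(cardC (mem C)) addKn.
pose F (i : 'I_n) : {poly R} := if i \in B then 1 else -1.
pose G (i : 'I_n) : {poly R} := if i \in B then 0 else 'X.
transitivity (\prod_(i : 'I_n) (F i + G i)); last first.
  rewrite (bigID (mem B)) /= big1 ?mul1r; last first.
    by move=> i iB; rewrite /F /G iB addr0.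
  under eq_bigr => i iB do rewrite /F /G (negbTE iB) addrC.
  rewrite prodr_const; congr (_ ^+ _).
  exact: cardC'.
rewrite bigA_distr big_mkcond /=; apply: eq_bigr => A _.
have [BA|/subsetPn[i iB iA]] := boolP (B \subset A); last first.
  by rewrite (bigD1 i) //= (negbTE iA) /G iB mul0r.
rewrite (bigID (mem A)) /= (bigID (mem B)) /= big1 ?mul1r; last first.
  by move=> i /andP[-> iB]; rewrite /F iB.
under eq_bigr => i /andP[iA iB] do rewrite iA /F (negbTE iB).
under [X in _ = _ * X]eq_bigr => i iA.
  rewrite (negbTE iA) /G ifN; last by apply: contraNN iA => /(fintype.subsetP BA).
  over.
rewrite !prodr_const -mul_polyC polyC_exp polyCN; congr (_ ^+ _ * 'X^_).
  rewrite -cardsDS//; apply: eq_card => i; rewrite !inE andbC.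
  by rewrite unfold_in /=.
exact/esym/cardC'.
Qed.

Lemma reflected_polyXn (R : realType) (n k : nat) : (k <= n)%N ->
  reflected_poly n 'X^k = 'X^(n - k) :> {poly R}.
Proof.
move=> kn; apply/polyP => i; rewrite coef_poly !coefXn ltnS.
have [i_n|n_i] := leqP i n; last first.
  by rewrite (gtn_eqF (leq_ltn_trans (leq_subr _ _) n_i)).
by congr (_%:R); congr nat_of_bool; apply/eqP/eqP => [<-|->]; rewrite subKn.
Qed.

Lemma reflected_poly_sumZ (R : realType) (n : nat) (I : finType)
    (a : I -> R) (f : I -> {poly R}) :
  reflected_poly n (\sum_i a i *: f i) = \sum_i a i *: reflected_poly n (f i).
Proof.
apply/polyP => i; rewrite coef_poly coef_sum.
have [i_n|n_i] := ifPn; last first.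
  by rewrite coef_sum big1// => j _; rewrite coefZ coef_poly (negbTE n_i) mulr0.
by rewrite coef_sum; apply: eq_bigr => j _; rewrite !coefZ coef_poly i_n.
Qed.

(** Reflection turns 'X^#|A| into 'X^(n - #|A|). After exchanging the two sums, each [B] with phi B
    = 1 collects the signed monomials of its supersets. *)
Lemma reflected_diagonal_section (R : realType) (n : nat)
    (phi : structure_function n) :
  reflected_poly n (diagonal_section phi) =
  \sum_(A : {set 'I_n}) (phi A)%:R *: ('X - 1%:P) ^+ (n - #|A|) :> {poly R}.
Proof.
rewrite reflected_poly_sumZ.
under eq_bigr => A _.
  rewrite reflected_polyXn ?card_le_ord// scaler_suml; over.
rewrite (exchange_big_dep xpredT) //=; apply: eq_bigr => B _.
rewrite -sum_supersets_sign_exp scaler_sumr; apply: eq_bigr => A _.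
by rewrite scalerA mulrC.
Qed.

Lemma sum_scale_by_card (R : realType) (n : nat) (phi : structure_function n)
    (F : nat -> {poly R}) :
  \sum_(A : {set 'I_n}) (phi A)%:R *: F (n - #|A|)%N =
  \sum_(0 <= k < n.+1)
    (\sum_(A : {set 'I_n} | #|A| == (n - k)%N) (phi A)%:R) *: F k.
Proof.
rewrite big_mkord.
(* [inord] never takes its default value here, since n - #|A| is at most n. *)
pose p (A : {set 'I_n}) : 'I_n.+1 := inord (n - #|A|).
rewrite (partition_big p xpredT)//= /p.
apply: eq_bigr => k _; rewrite scaler_suml; apply: eq_big => [A|A /eqP <-].
  rewrite -val_eqE /= inordK ?ltnS ?leq_subr//.
  by apply/eqP/eqP => [<-|->]; rewrite subKn ?card_le_ord// -ltnS.
by rewrite inordK ?ltnS ?leq_subr.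
Qed.

(** The sum is q composed with 'X - c. The inner polynomial has derivative 1, so derivation commutes
    with the composition, and evaluating at c reads the k-th derivative of q at 0. *)
Lemma taylor_coef_sum_exp (R : realType) (n k : nat) (a : nat -> R) (c : R) :
  (k <= n)%N ->
  ((\sum_(0 <= i < n.+1) a i *: ('X - c%:P) ^+ i)^`(k)).[c] / (k`!)%:R = a k.
Proof.
move=> kn; set q := \poly_(i < n.+1) a i.
have -> : \sum_(0 <= i < n.+1) a i *: ('X - c%:P) ^+ i = q \Po ('X - c%:P).
  rewrite big_mkord /q poly_def linear_sum /=; apply: eq_bigr => i _.
  by rewrite linearZ /= rmorphXn /= comp_polyX.
have -> : (q \Po ('X - c%:P))^`(k) = q^`(k) \Po ('X - c%:P).
  elim: (k) => // m IH; rewrite !derivnS IH deriv_comp derivB derivX derivC.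
  by rewrite subr0 mulr1.
rewrite horner_comp hornerXsubC subrr horner_coef0 coef_derivn addn0 ffactnn.
rewrite coef_poly ltnS kn -[X in X / _]mulr_natr mulfK //.
Qed.

(** * Rankings of the lifetimes and the sets of survivors *)

(** The strict order of the lifetimes as a finite object: a random ranking has finitely many values,
    so probabilities become finite sums. *)
Definition ranking (R : realType) (n : nat) (t : 'I_n -> R) :
  {set 'I_n * 'I_n} := [set p | t p.1 < t p.2]%SET.

Definition rank_in (n : nat) (r : {set 'I_n * 'I_n}) (i : 'I_n) : nat :=
  #|[set j | (j, i) \in r]%SET|.

(** Ranks count from 0, so without ties these are the components that outlive the first [k]
    failures. *)
Definition survivors (n : nat) (k : nat) (r : {set 'I_n * 'I_n}) :
  {set 'I_n} := [set i | (k <= rank_in r i)%N]%SET.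

Definition tie_free (n : nat) (r : {set 'I_n * 'I_n}) : bool :=
  [forall i, forall j, (i != j) ==> ((i, j) \in r) || ((j, i) \in r)].

(* T_S = T_{k+1:n}, read off from the ranking alone; stated so as to remain exact
   in the presence of ties, because the event itself has to be measurable. *)
Definition fails_at (n : nat) (phi : structure_function n) (k : nat)
    (r : {set 'I_n * 'I_n}) : bool :=
  [exists i, [&& phi [set j | (j, i) \notin r]%SET,
                 ~~ phi [set j | (i, j) \in r]%SET,
                 (rank_in r i <= k)%N &
                 (k < #|[set j | (i, j) \notin r]%SET|)%N]].

Lemma semicoherent_subset (n : nat) (phi : structure_function n)
    (A B : {set 'I_n}) : semicoherent phi -> A \subset B -> phi A -> phi B.
Proof.
move=> [mono _ _] AB phiA.
(* Semicoherence only allows adding one element at a time, so [B] is written as [A] enlarged by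
   singletons. *)
have -> : B = (\bigcup_(i in B) [set i] :|: A)%SET.
  apply/setP => j; rewrite !inE; apply/idP/idP => [jB|].
    by apply/orP; left; apply/bigcupP; exists j; rewrite ?inE.
  case/orP => [/bigcupP[i iB]|/(fintype.subsetP AB)//].
  by rewrite inE => /eqP ->.
elim/big_rec : _ => [|i C _ IH]; first by rewrite finset.set0U.
by rewrite -finset.setUA; exact: mono.
Qed.

(** * System lifetime and order statistics in terms of the ranking *)

Section SystemLifetime.
Context {R : realType} {n : nat}.
Variables (phi : structure_function n) (phi_sc : semicoherent phi).
Variable t : 'I_n -> R.

(** By monotonicity the times at which the system works form exactly the open ray below [t i]. *)
Lemma system_lifetime_eq (i : 'I_n) :
  phi [set j | t i <= t j]%SET -> ~~ phi [set j | t i < t j]%SET ->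
  system_lifetime phi t = t i.
Proof.
move=> phi_ge phi_gt; rewrite /system_lifetime.
rewrite (_ : [set u : R | _] = [set` `]-oo, t i[]) ?sup_itv ?ltNyr//.
apply/seteqP; split => u /=; rewrite in_itv /=.
  move=> phi_u; rewrite ltNge; apply: contraNN phi_gt => tiu.
  apply: (semicoherent_subset phi_sc) phi_u; apply/fintype.subsetP => j.
  by rewrite !inE; exact: le_lt_trans.
move=> uti; apply: (semicoherent_subset phi_sc) phi_ge.
by apply/fintype.subsetP => j; rewrite !inE; exact: lt_le_trans.
Qed.

(** Take the largest [t i] for which phi holds on the components lasting at least that long. If phi
    still held on those lasting strictly longer, the smallest lifetime among them would contradict
    maximality. *)
Lemma system_lifetime_attained : exists i : 'I_n,
  phi [set j | t i <= t j]%SET /\ ~~ phi [set j | t i < t j]%SET.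
Proof.
have [_ phi0 phiT] := phi_sc.
(* There is a component at all because phi differs on the empty and the full set. *)
have [i0 _] : exists i : 'I_n, i \in [set: 'I_n]%SET.
  by apply/set0Pn; apply: contraNneq phi0 => <-.
have phi_le i (A : {set 'I_n}) : phi A -> (forall j, j \in A -> t i <= t j) ->
    phi [set j | t i <= t j]%SET.
  move=> phiA iA; apply: (semicoherent_subset phi_sc) phiA.
  by apply/fintype.subsetP => j /iA; rewrite inE.
have phi_min : phi [set j | t [arg min_(i < i0) t i]%O <= t j]%SET.
  apply: phi_le phiT _ => j _.
  by case: arg_minP => // i _; apply.
case: (@arg_maxP _ _ _ _ (fun i => phi [set j | t i <= t j]%SET) t phi_min).
move=> i phi_ge max_i; exists i; split => //; apply/negP => phi_gt.
have [i1 i1A] : exists i1, t i < t i1.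
  have /set0Pn[i1] : [set j | t i < t j]%SET != finset.set0.
    by apply: contraNneq phi0 => <-.
  by rewrite inE; exists i1.
case: (@arg_minP _ _ _ _ (fun j => t i < t j) t i1A) => i2 lt_i min_i2.
have /max_i : phi [set j | t i2 <= t j]%SET.
  by apply: phi_le phi_gt _ => j; rewrite inE; exact: min_i2.
by rewrite /= leNgt lt_i.
Qed.

(** In a sorted list, the entry at position [k] (from 0) equals v exactly when at most [k] entries
    lie below v and more than [k] are at most v. *)
Lemma order_statisticP (k : nat) (i : 'I_n) : (k < n)%N ->
  order_statistic t k.+1 = t i <->
  (#|[set j | (t j < t i)%R]%SET| <= k < #|[set j | (t j <= t i)%R]%SET|)%N.
Proof.
move=> kn; rewrite /order_statistic /=.
set s := sort _ _.
have sorted_s : sorted <=%R s by exact: sort_le_sorted.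
have size_s : size s = n by rewrite size_sort size_map size_enum_ord.
have countE (a : pred R) : count a s = #|[set j | a (t j)]%SET|.
  by rewrite count_sort count_map cardsE cardE enumT size_filter -enumT.
have -> : #|[set j | t j < t i]%SET| = count (< t i) s by rewrite countE.
have -> : #|[set j | t j <= t i]%SET| = count (<= t i) s by rewrite countE.
split=> [E|]; last exact: nth_count_eq.
apply/andP; split; rewrite leqNgt; apply/negP => H.
  by have := nth_count_lt 0 sorted_s H; rewrite E ltxx.
have : (count (<= t i) s <= k < size s)%N by rewrite size_s kn andbT -ltnS.
by move=> /(nth_count_gt 0 sorted_s); rewrite E ltxx.
Qed.

Lemma signature_event (k : nat) : (k < n)%N ->
  system_lifetime phi t = order_statistic t k.+1 <->
  fails_at phi k (ranking t).
Proof.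
move=> kn.
have ge_i i : [set j | (j, i) \notin ranking t]%SET = [set j | t i <= t j]%SET.
  by apply/setP => j; rewrite !inE leNgt.
have gt_i i : [set j | (i, j) \in ranking t]%SET = [set j | t i < t j]%SET.
  by apply/setP => j; rewrite !inE.
have lt_i i : rank_in (ranking t) i = #|[set j | t j < t i]%SET|.
  by apply: eq_card => j; rewrite !inE.
have le_i i : [set j | (i, j) \notin ranking t]%SET = [set j | t j <= t i]%SET.
  by apply/setP => j; rewrite !inE leNgt.
split=> [E|/existsP[i]].
  have [i [ge0 gt0]] := system_lifetime_attained.
  have Ei := system_lifetime_eq ge0 gt0.
  apply/existsP; exists i; rewrite ge_i gt_i lt_i le_i ge0 gt0 /=.
  by apply/order_statisticP => //; rewrite -E.
rewrite ge_i gt_i lt_i le_i => /and3P[ge0 gt0 kcard].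
by rewrite (system_lifetime_eq ge0 gt0); apply/esym/order_statisticP.
Qed.

End SystemLifetime.

(** * Survivors of a tie-free ranking *)

Section Ranking.
Context {R : realType} {n : nat}.
Variable t : 'I_n -> R.

Lemma rank_in_ranking i : rank_in (ranking t) i = #|[set j | t j < t i]%SET|.
Proof. by apply: eq_card => j; rewrite !inE. Qed.

Lemma ltn_rank_in i j :
  (rank_in (ranking t) i < rank_in (ranking t) j)%N = (t i < t j).
Proof.
rewrite !rank_in_ranking; apply/idP/idP => [|ij].
  rewrite ltnNge ltNge; apply: contraNN => ji; apply/subset_leq_card.
  by apply/fintype.subsetP => l; rewrite !inE => /lt_le_trans; apply.
apply/proper_card/properP; split.
  by apply/fintype.subsetP => l; rewrite !inE => /lt_trans; apply.
by exists i; rewrite !inE ?ltxx.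
Qed.

Lemma rank_in_lt i : (rank_in (ranking t) i < n)%N.
Proof.
rewrite rank_in_ranking -[X in (_ < X)%N](card_ord n) -cardsT.
apply/proper_card/properP; split; first exact: finset.subsetT.
by exists i; rewrite !inE ?ltxx.
Qed.

Lemma tie_freeP : reflect (injective t) (tie_free (ranking t)).
Proof.
apply: (iffP forallP) => [H i j tij|inj_t i].
  apply/eqP; apply: contraTT isT => ij.
  by move/forallP: (H i) => /(_ j); rewrite ij !inE /= tij ltxx.
apply/forallP => j; apply/implyP => ij; rewrite !inE /= -neq_lt.
by apply: contraNneq ij => /inj_t ->.
Qed.

Lemma survivors_ge (k : nat) : (n <= k)%N ->
  survivors k (ranking t) = finset.set0.
Proof.
move=> nk; apply/setP => i; rewrite !inE; apply/negbTE; rewrite -ltnNge.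
exact: leq_trans (rank_in_lt i) nk.
Qed.

Hypothesis t_inj : injective t.

(** Without ties the rank is a bijection onto 'I_n, and the survivors are the preimage of the ranks
    from [k] on. *)
Lemma card_survivors (k : nat) : #|survivors k (ranking t)| = (n - k)%N.
Proof.
pose f i := Ordinal (rank_in_lt i).
have f_inj : injective f.
  move=> i j /(congr1 val) /= E; apply: t_inj; apply/eqP.
  by rewrite eq_le !leNgt -!ltn_rank_in E ltnn.
have -> : survivors k (ranking t) = (f @^-1: [set i : 'I_n | (k <= i)%N])%SET.
  by apply/setP => i; rewrite !inE.
rewrite on_card_preimset; last exact: onW_bij (injF_bij f_inj).
rewrite -sum1_card big_mkcond /=.
under eq_bigr do rewrite inE.
rewrite -big_mkcond /= -(big_mkord (fun i => k <= i)%N (fun=> 1%N)).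
have [kn|nk] := leqP k n; last first.
  rewrite big_nat_cond big_pred0; first by apply/esym/eqP; rewrite subn_eq0 ltnW.
  move=> i; apply/negP => /andP[/andP[_ i_n] ki].
  by have := leq_ltn_trans ki i_n; rewrite ltnNge (ltnW nk).
rewrite (@big_cat_nat _ _ _ k) //= big_nat_cond big_pred0 ?add0n; last first.
  by move=> i; apply/negP => /andP[/andP[_ ik]]; rewrite leqNgt ik.
rewrite big_nat_cond -[RHS]muln1 -sum_nat_const_nat [RHS]big_nat_cond.
by apply: eq_bigl => i; case: (k <= i)%N; rewrite ?andbF ?andbT.
Qed.

(** Without ties the two cardinality bounds in [fails_at] force the witness to have rank exactly
    [k]. Conversely, if phi separates the two survivor sets they differ, and a component in the
    difference has rank [k]. *)
Lemma fails_at_survivors (phi : structure_function n) (k : nat) :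
  fails_at phi k (ranking t) =
  phi (survivors k (ranking t)) && ~~ phi (survivors k.+1 (ranking t)).
Proof.
have ge_k i : rank_in (ranking t) i = k ->
    [set j | (j, i) \notin ranking t]%SET = survivors k (ranking t).
  by move=> <-; apply/setP => j; rewrite !inE -ltn_rank_in -leqNgt.
have gt_k i : rank_in (ranking t) i = k ->
    [set j | (i, j) \in ranking t]%SET = survivors k.+1 (ranking t).
  by move=> <-; apply/setP => j; rewrite !inE -ltn_rank_in.
have le_i i : #|[set j | (i, j) \notin ranking t]%SET| =
    (rank_in (ranking t) i).+1.
  transitivity #|(i |: [set j | t j < t i])%SET|; last first.
    by rewrite cardsU1 rank_in_ranking !inE ltxx.
  by apply: eq_card => j; rewrite !inE /= -leNgt le_eqVlt (inj_eq t_inj).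
apply/existsP/andP => [[i /and4P[phi_ge phi_gt rank_le k_lt]]|[phi_k phi_k1]].
  suff rank_i : rank_in (ranking t) i = k by rewrite -(ge_k i) // -(gt_k i).
  by apply/eqP; rewrite eqn_leq rank_le -ltnS -le_i.
have : ~~ (survivors k (ranking t) \subset survivors k.+1 (ranking t)).
  apply: contraNN phi_k1 => sub; rewrite (_ : survivors k.+1 _ = survivors k (ranking t)) //.
  apply/eqP; rewrite finset.eqEsubset sub andbT.
  by apply/fintype.subsetP => i; rewrite !inE; exact: ltnW.
move=> /subsetPn[i]; rewrite !inE -ltnNge ltnS => ki ik.
have rank_i : rank_in (ranking t) i = k by apply/eqP; rewrite eqn_leq ik.
exists i; rewrite ge_k // gt_k // phi_k phi_k1 rank_i leqnn /=.
by rewrite le_i rank_i.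
Qed.

Lemma survivors_comp (s : {perm 'I_n}) (k : nat) :
  survivors k (ranking (t \o s)) = (s @^-1: survivors k (ranking t))%SET.
Proof.
apply/setP => i; rewrite !inE !rank_in_ranking; congr (_ <= _)%N.
rewrite -(card_preimset _ (@perm_inj _ s)); apply: eq_card => j.
by rewrite !inE.
Qed.

End Ranking.

(** * Joint law of the lifetimes and exchangeability *)

(** Boxes are stable under intersection, so this choice of generators makes the uniqueness theorem
    for measures applicable. *)
Lemma measurable_tupleE (d : measure_display) (S : measurableType d) (n : nat) :
  @measurable _ (n.-tuple S) =
  <<s [set [set x : n.-tuple S | forall i, B i (tnth x i)] |
        B in [set B : 'I_n -> set S | forall i, measurable (B i)]] >>.
Proof.
apply/seteqP; split.
  apply: smallest_sub; first exact: smallest_sigma_algebra.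
  rewrite -bigcup_seq; apply: bigcup_sub => i _ _ [Y mY <-].
  rewrite setTI; apply: sub_sigma_algebra.
  (* A cylinder over one coordinate is a box whose other sides are full. *)
  exists (fun j => if j == i then Y else setT) => /=.
    by move=> j; case: ifP.
  apply/seteqP; split => [x /(_ i)|x Yx j]; rewrite ?eqxx//.
  by case: ifP => // /eqP ->.
apply: smallest_sub; first exact: sigma_algebra_measurable.
move=> _ [B mB <-].
rewrite (_ : [set x | _] =
    \bigcap_(i in [set: 'I_n]) ((fun x : n.-tuple S => tnth x i) @^-1` B i)).
  apply: fin_bigcap_measurable => // i _.
  by rewrite -[X in measurable X]setTI; exact: measurable_tnth.
by apply/seteqP; split => x /= H i => [_|]; exact: H.
Qed.

Section JointLaw.
Context {R : realType} {n : nat} {d : measure_display} {Omega : measurableType d}.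
Variable P : probability Omega R.
Implicit Types X Y : 'I_n -> {RV P >-> R}.

Let vec X w : n.-tuple R := [tuple X i w | i < n].

Let measurable_vec X : measurable_fun [set: Omega] (vec X).
Proof.
apply/measurable_fun_tnthP => i.
rewrite (_ : _ \o _ = X i); first exact: measurable_funPT.
by apply/funext => w /=; rewrite tnth_mktuple.
Qed.

Lemma joint_law_unique X Y :
  (forall B : 'I_n -> set R, (forall i, measurable (B i)) ->
     P [set w | forall i, B i (X i w)] = P [set w | forall i, B i (Y i w)]) ->
  forall E : set (n.-tuple R), measurable E ->
    P [set w | E [tuple X i w | i < n]] = P [set w | E [tuple Y i w | i < n]].
Proof.
move=> XY E mE.
pose law Z := distribution P (mfun_Sub (mem_set (measurable_vec Z)) :
  {mfun Omega >-> n.-tuple R}).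
change (law X E = law Y E).
pose rectangles := [set [set x : n.-tuple R | forall i, B i (tnth x i)] |
  B in [set B : 'I_n -> set R | forall i, measurable (B i)]].
apply: (measure_unique rectangles (fun=> setT)) => //.
- exact: measurable_tupleE.
- move=> _ _ [A mA <-] [B mB <-]; exists (fun i => A i `&` B i) => /=.
    by move=> i; exact: measurableI.
  apply/seteqP; split => x /= => [AB|[Ax Bx] i]; last by split.
  by split=> i; have [] := AB i.
- by move=> _; exists (fun=> setT) => //; apply/seteqP; split.
- by rewrite bigcup_const.
- move=> _ [B mB <-].
  have lawE Z : law Z [set x | forall i, B i (tnth x i)] =
                P [set w | forall i, B i (Z i w)].
    congr (P _); apply/seteqP; split => w /= H i; have := H i;
    by rewrite tnth_mktuple.
  exact: etrans (lawE X) (etrans (XY B mB) (esym (lawE Y))).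
- move=> _; rewrite [X in (X < _)%E](_ : _ = 1%E) ?ltry//.
  exact: (@probability_setT _ _ _ (law X)).
Qed.

(** The event is a finite union, over the rankings satisfying [Q], of finite intersections of
    comparisons between two coordinates. *)
Lemma measurable_ranking (Q : pred {set 'I_n * 'I_n}) :
  measurable [set x : n.-tuple R | Q (ranking (tnth x))].
Proof.
rewrite (_ : [set x | _] = \bigcup_(r in [set r | Q r])
    \bigcap_(p in [set: 'I_n * 'I_n])
      [set x : n.-tuple R | (tnth x p.1 < tnth x p.2) = (p \in r)]).
  apply: fin_bigcup_measurable => // r _.
  apply: fin_bigcap_measurable => // p _.
  have mlt : measurable_fun [set: n.-tuple R]
      (fun x : n.-tuple R => tnth x p.1 < tnth x p.2).
    by apply: measurable_fun_ltr; exact: measurable_tnth.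
  by rewrite -[X in measurable X]setTI; apply: (mlt _ [set (p \in r)]).
apply/seteqP; split => x /= => [Qx|[r Qr xr]].
  by exists (ranking (tnth x)) => //= p _; rewrite inE.
suff -> : ranking (tnth x) = r by [].
by apply/setP => p; rewrite inE; exact: xr.
Qed.

Lemma measurable_rankingRV X (Q : pred {set 'I_n * 'I_n}) :
  measurable [set w | Q (ranking (fun i => X i w))].
Proof.
rewrite -[X in measurable X]setTI.
have := measurable_vec X measurableT (measurable_ranking Q).
congr (measurable (_ `&` _)); apply/seteqP; split => w /=;
by rewrite (_ : tnth _ = fun i => X i w) //; apply/funext => i;
   rewrite tnth_mktuple.
Qed.

(** On boxes both joint laws are products of the same one-dimensional probabilities, up to the order
    of the factors; equality on boxes determines the joint law. *)
Lemma exchangeable_ranking X (s : {perm 'I_n}) (Q : pred {set 'I_n * 'I_n}) :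
  independent_RVs X -> identically_distributed X ->
  P [set w | Q (ranking (fun i => X (s i) w))] =
  P [set w | Q (ranking (fun i => X i w))].
Proof.
move=> ind_X id_X.
have rectE (B : 'I_n -> set R) : (forall i, measurable (B i)) ->
    P [set w | forall i, B i (X i w)] = (\prod_i P (X i @^-1` B i))%E.
  move=> mB; have := ind_X [set: 'I_n]%SET B (fun i _ => mB i).
  rewrite (eq_bigl xpredT) => [<-|i]; last by rewrite inE.
  congr (P _); apply/seteqP; split => w /= H i => [_|]; first exact: H.
  by apply: H; rewrite /= inE.
have rectsE (B : 'I_n -> set R) : (forall i, measurable (B i)) ->
    P [set w | forall i, B i (X (s i) w)] = P [set w | forall i, B i (X i w)].
  move=> mB; rewrite rectE//.
  (* The permutation is moved from the variables to the sides of the box. *)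
  transitivity (P [set w | forall i, B ((s^-1)%g i) (X i w)]).
    congr (P _); apply/seteqP; split => w /= H i.
      by have := H ((s^-1)%g i); rewrite permKV.
    by have := H (s i); rewrite permK.
  rewrite (rectE (fun i => B ((s^-1)%g i)))// (reindex_inj (@perm_inj _ s)) /=.
  apply: eq_bigr => i _.
  by rewrite permK; exact: id_X.
have := joint_law_unique rectsE (measurable_ranking Q).
have vecE (Z : 'I_n -> {RV P >-> R}) :
    [set w | [set x : n.-tuple R | Q (ranking (tnth x))] [tuple Z i w | i < n]]
    = [set w | Q (ranking (fun i => Z i w))].
  by apply/seteqP; split => w /=;
    rewrite (_ : tnth _ = fun i => Z i w) //; apply/funext => i;
    rewrite tnth_mktuple.
by rewrite (vecE (fun i => X (s i))) vecE.
Qed.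

End JointLaw.

(** * Ties have probability zero *)

Section NoTies.
Context {R : realType} {d : measure_display} {Omega : measurableType d}.
Variable P : probability Omega R.
Local Open Scope ereal_scope.

(** For y < x the distribution function F satisfies F(y) <= F(x) - mu{x}. Letting y tend to x from
    the left, continuity gives F(x) <= F(x) - mu{x}. *)
Lemma distribution_set1_eq0 (X : {RV P >-> R}) (x : R) :
  continuous (cdf X : R -> \bar R) -> distribution P X [set x] = 0.
Proof.
move=> /(_ x) cdf_x; set mu := distribution P X.
have fin A : measurable A -> mu A \is a fin_num.
  by move=> ?; exact: fin_num_measure.
have cdf_lt (y : R) : (y < x)%R -> cdf X y <= cdf X x - mu [set x].
  move=> yx; rewrite leeBrDr ?fin//.
  rewrite /cdf -/mu -measureU//; last first.
    apply/seteqP; split => // z [/=]; rewrite in_itv /= => zy zx.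
    by move: zy; rewrite zx leNgt yx.
  apply: le_measure; rewrite ?inE//; first exact: measurableU.
  move=> z [|->] /=; rewrite !in_itv /= ?lexx// => zy.
  exact: le_trans zy (ltW yx).
have : cdf X x <= cdf X x - mu [set x].
  have cdf_left : cdf X y @[y --> x^'-] --> cdf X x.
    exact: cvg_at_left_filter.
  rewrite -{1}(cvg_lim _ cdf_left)//; apply: lime_le.
    by apply/cvg_ex; eexists; exact: cdf_left.
  by near=> y; apply: cdf_lt; near: y; exact: nbhs_left_lt.
have fx : cdf X x \is a fin_num by exact: fin.
rewrite leeBrDr ?fin// -[leRHS]adde0 leeD2lE// => mu_le0.
by apply/eqP; rewrite eq_le mu_le0 measure_ge0.
Unshelve. all: by end_near. Qed.

(** By independence the law of the pair is the product law, and each section of the diagonal is a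
    single point, which is null for the law of [T j]. *)
Lemma independent_RVs_neq (n : nat) (T : 'I_n -> {RV P >-> R}) (i j : 'I_n) :
  independent_RVs T -> continuously_distributed T -> i != j ->
  P [set w | T i w = T j w] = 0.
Proof.
move=> indT contT ij.
have mZ : measurable_fun [set: Omega] (fun w => (T i w, T j w)).
  by apply: measurable_fun_pair; exact: measurable_funPT.
pose Z : {mfun Omega >-> (R * R)%type} := mfun_Sub (mem_set mZ).
pose diag : set (R * R)%type := [set p | p.1 = p.2].
have mdiag : measurable diag.
  have meq : measurable_fun [set: (R * R)%type] (fun p : (R * R)%type => p.1 == p.2).
    by apply: measurable_fun_eqr.
  rewrite (_ : diag = setT `&` (fun p : (R * R)%type => p.1 == p.2) @^-1` [set true]).
    exact: meq.
  by rewrite setTI; apply/seteqP; split => p /= /eqP.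
have -> : P [set w | T i w = T j w] = distribution P Z diag by [].
rewrite -(@product_measure_unique _ _ _ _ _ (distribution P (T i))
  (distribution P (T j))) //.
  rewrite /product_measure1 /= integral0_eq// => x _.
  rewrite (_ : xsection diag x = [set x]); first exact: distribution_set1_eq0.
  by apply/seteqP; split => y; rewrite /xsection /= inE /diag /=.
move=> A B mA mB.
have := indT [set i; j]%SET (fun l => if l == i then A else B).
rewrite big_setU1 ?inE//= big_set1 eqxx eq_sym (negbTE ij) => <-.
  congr (P _); apply/seteqP; split => w /=.
    move=> [Aw Bw] l; rewrite /= !inE => /orP[/eqP ->|/eqP ->];
    by rewrite ?eqxx// eq_sym (negbTE ij).
  move=> H; split.
    by have := H i; rewrite /= !inE !eqxx; apply.
  by have := H j; rewrite /= !inE eqxx orbT eq_sym (negbTE ij); apply.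
by move=> l _; case: ifP.
Qed.

End NoTies.

(** * Uniform law of the survivors and Boland's formula *)

(** The indicator tuples of [A] and [B] contain each Boolean equally often, so one is a
    rearrangement of the other. *)
Lemma exists_perm_preimset (n : nat) (A B : {set 'I_n}) : #|A| = #|B| ->
  exists s : {perm 'I_n}, (s @^-1: B)%SET = A.
Proof.
move=> cAB.
have count_mem (C : {set 'I_n}) (a : pred bool) :
    count a (map_tuple (mem C) (ord_tuple n)) =
    ((if a true then #|C| else 0) + (if a false then n - #|C| else 0))%N.
  have cC : count (mem C) (enum 'I_n) = #|C|.
    by rewrite cardE enumT size_filter -enumT; apply: eq_count.
  have cC' : count (predC (mem C)) (enum 'I_n) = (n - #|C|)%N.
    apply/eqP; rewrite -(eqn_add2l #|C|) subnKC ?card_le_ord// -{1}cC.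
    by rewrite count_predC size_enum_ord.
  rewrite /= count_map; case: ifP => aT; case: ifP => aF.
  - rewrite subnKC ?card_le_ord// -[RHS](size_enum_ord n) -count_predT.
    by apply: eq_count => i /=; case: (i \in C).
  - by rewrite addn0 -cC; apply: eq_count => i /=; case: (i \in C).
  - rewrite add0n -cC'; apply: eq_count => i /=.
    by case: (i \in C); rewrite ?aT ?aF.
  - rewrite addn0 -(count_pred0 (enum 'I_n)); apply: eq_count => i /=.
    by case: (i \in C).
have /tuple_permP[s sE] : perm_eq (map_tuple (mem A) (ord_tuple n))
                                  (map_tuple (mem B) (ord_tuple n)).
  by apply/seq.permP => a; rewrite !count_mem cAB.
exists s; apply/setP => i; rewrite inE.
have /(congr1 (fun u => tnth u i)) : map_tuple (mem A) (ord_tuple n) =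
    [tuple tnth (map_tuple (mem B) (ord_tuple n)) (s i) | i < n].
  exact: val_inj.
by rewrite tnth_mktuple !tnth_map !tnth_ord_tuple.
Qed.

Section Boland.
Context {R : realType} {n : nat} {d : measure_display} {Omega : measurableType d}.
Context {P : probability Omega R}.
Variable T : 'I_n -> {RV P >-> R}.
Hypotheses (indT : independent_RVs T) (idT : identically_distributed T)
  (contT : continuously_distributed T).

Let rk w := ranking (fun i => T i w).
Let mu r : R := fine (P [set w | rk w == r]).

Lemma prob_ranking (Q : pred {set 'I_n * 'I_n}) :
  fine (P [set w | Q (rk w)]) = \sum_(r | Q r) mu r.
Proof.
have mrk r : measurable [set w | rk w == r].
  exact: (measurable_rankingRV T (pred1 r)).
rewrite (_ : [set w | _] =
    \bigcup_(r in [set` enum Q]) [set w | rk w == r]); last first.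
  apply/seteqP; split => w /= => [Qw|[r]].
    by exists (rk w); rewrite //= mem_enum.
  by rewrite /= mem_enum => Qr /eqP ->.
rewrite measure_fin_bigcup//; last first.
  apply/trivIsetP => r1 r2 _ _ r12; apply/seteqP; split => // w /=.
  by move=> [/eqP -> /eqP /eqP]; rewrite (negbTE r12).
rewrite -fsbig_seq ?enum_uniq// big_enum /= -sum_fine// => r _.
exact: fin_num_measure.
Qed.

(** A ranking of nonzero mass occurs for some outcome, and it cannot have ties because those are
    null. Sums weighted by [mu] may thus be restricted to rankings of injective lifetimes. *)
Lemma ranking_law_neq0 r :
  mu r != 0 -> exists2 t : 'I_n -> R, injective t & ranking t = r.
Proof.
move=> mu_r.
have [w /= /eqP rkw] : exists w, rk w == r.
  apply: contra_notP (elimN eqP mu_r) => no_w; rewrite /mu.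
  rewrite (_ : [set w | _] = set0) ?measure0//.
  by apply/seteqP; split => // w rkw; apply: no_w; exists w.
exists (fun i => T i w) => //; apply/tie_freeP; rewrite -/(rk w) rkw.
apply: contraNT mu_r => /forallPn[i /forallPn[j]].
rewrite negb_imply negb_or => /and3P[ij ijr jir].
rewrite /mu (subset_measure0 _ _ _ (independent_RVs_neq indT contT ij)) //.
- exact: (measurable_rankingRV T (pred1 r)).
- rewrite (_ : [set w | _] = setT `&` (fun w => T i w == T j w) @^-1` [set true]).
    apply: measurable_fun_eqr => //; exact: measurable_funPT.
  by rewrite setTI; apply/seteqP; split => v /= /eqP.
move=> v /= /eqP rkv; apply/eqP; rewrite eq_le !leNgt.
by move: ijr jir; rewrite -rkv !inE /= => -> ->.
Qed.

(** The law of the survivor set vanishes off the sets of size n - k, is constant on them by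
    exchangeability, and has total mass 1; there are 'C(n, k) such sets. *)
Lemma prob_survivors (k : nat) (A : {set 'I_n}) : (k <= n)%N ->
  \sum_(r | survivors k r == A) mu r =
  (#|A| == n - k)%N%:R / 'C(n, k)%:R.
Proof.
move=> kn.
pose nu B : R := fine (P [set w | survivors k (rk w) == B]).
have nuE B : nu B = \sum_(r | survivors k r == B) mu r.
  exact: (prob_ranking (fun r => survivors k r == B)).
have nu_const (B C : {set 'I_n}) :
    #|B| = (n - k)%N -> #|C| = (n - k)%N -> nu B = nu C.
  move=> cB cA; have [s <-] := exists_perm_preimset (etrans cB (esym cA)).
  rewrite /nu.
  (* Relabelling by [s] replaces the survivor set by its preimage, which equals the preimage of [C]
     exactly when the survivor set is [C]. *)
  have <- := exchangeable_ranking s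
    (fun r => survivors k r == (s @^-1: C)%SET) indT idT.
  congr (fine (P _)); apply/seteqP; split => w /=;
    rewrite (survivors_comp (fun i => T i w) s) => /eqP.
    move=> /setP H; apply/eqP/setP => i; have := H ((s^-1)%g i).
    by rewrite [LHS]inE [RHS]inE permKV.
  by move=> ->.
have nu_0 (B : {set 'I_n}) : #|B| != (n - k)%N -> nu B = 0.
  move=> cB; rewrite nuE big1// => r /eqP rB; apply/eqP; apply: contraNT cB.
  by move=> /ranking_law_neq0[t t_inj tr]; rewrite -rB -tr card_survivors.
have nu_sum : \sum_B nu B = 1.
  under eq_bigr do rewrite nuE.
  transitivity (\sum_r mu r).
    by rewrite [RHS](partition_big (survivors k) xpredT).
  rewrite -(prob_ranking xpredT).
  by rewrite (_ : [set w | _] = setT) ?probability_setT//; exact/seteqP.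
rewrite -nuE; have [cA|/nu_0->] := eqVneq #|A| (n - k)%N; last by rewrite mul0r.
have : nu A *+ 'C(n, k) = 1.
  rewrite -nu_sum (bigID (fun B : {set 'I_n} => #|B| == n - k)%N) /=.
  rewrite [X in _ + X]big1 ?addr0; last exact: nu_0.
  rewrite (eq_bigr (fun=> nu A)) => [|B /eqP cB]; last exact: nu_const.
  rewrite sumr_const; congr (_ *+ _).
  have := card_draws 'I_n (n - k)%N; rewrite card_ord bin_sub// => <-.
  by apply: eq_card => B; rewrite inE.
move=> E; rewrite -[LHS](mulfK (x := 'C(n, k)%:R)).
  by rewrite mulr_natr E.
by rewrite pnatr_eq0 -lt0n bin_gt0.
Qed.

Lemma tail_signatureE (phi : structure_function n) (k : nat) :
  semicoherent phi -> (k <= n)%N ->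
  tail_signature phi T k = \sum_(r | phi (survivors k r)) mu r.
Proof.
move=> phi_sc kn.
have sigE i : (i < n)%N -> signature phi T i.+1 =
    \sum_r mu r * ((phi (survivors i r))%:R - (phi (survivors i.+1 r))%:R).
  move=> i_n; rewrite /signature.
  rewrite (_ : [set w | _] = [set w | fails_at phi i (rk w)]); last first.
    apply/seteqP; split => w /=;
    by have [] := signature_event phi_sc (fun i => T i w) i_n.
  rewrite prob_ranking big_mkcond; apply: eq_bigr => r _.
  have [->|/ranking_law_neq0[t t_inj <-]] := eqVneq (mu r) 0.
    by rewrite mul0r if_same.
  rewrite fails_at_survivors//.
  (* Survivor sets decrease, so by monotonicity the difference of the two indicators is the
     indicator of the failure event. *)
  have : phi (survivors i.+1 (ranking t)) -> phi (survivors i (ranking t)).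
    apply: semicoherent_subset => //; apply/fintype.subsetP => j.
    by rewrite !inE; exact: ltnW.
  case: (phi (survivors i _)); case: (phi (survivors i.+1 _)) => //= H.
  - by rewrite subrr mulr0.
  - by rewrite subr0 mulr1.
  - by have := H isT.
  - by rewrite subrr mulr0.
rewrite /tail_signature big_add1 /=.
rewrite (eq_big_nat _ _ (F2 := fun i => \sum_r mu r *
  ((phi (survivors i r))%:R - (phi (survivors i.+1 r))%:R))); last first.
  by move=> i /andP[_ i_n]; exact: sigE.
rewrite exchange_big [RHS]big_mkcond /=; apply: eq_bigr => r _.
rewrite -mulr_sumr.
rewrite (telescope_sumr_eq (fun i => - (phi (survivors i r))%:R)) //; last first.
  by move=> i _; rewrite opprK addrC.
rewrite opprK addrC.
have [->|/ranking_law_neq0[t t_inj <-]] := eqVneq (mu r) 0.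
  by rewrite mul0r if_same.
(* The upper end of the telescoping sum vanishes: nothing survives [n] failures. *)
have [_ /negbTE phi0 _] := phi_sc.
by rewrite (survivors_ge t (leqnn n)) phi0 subr0 mulr_natr mulrb.
Qed.

(** Split the tail probability by the value [A] of the survivor set; each [A] of size n - k on which
    phi holds contributes 1 / 'C(n, k). *)
Lemma boland_formula (phi : structure_function n) (k : nat) :
  semicoherent phi -> (k <= n)%N ->
  'C(n, k)%:R * tail_signature phi T k =
  \sum_(A : {set 'I_n} | #|A| == (n - k)%N) (phi A)%:R.
Proof.
move=> phi_sc kn; rewrite tail_signatureE//.
rewrite (partition_big (survivors k) xpredT)//= mulr_sumr [RHS]big_mkcond /=.
apply: eq_bigr => A _; have [phiA|phiA] := boolP (phi A); last first.
  rewrite if_same big_pred0 ?mulr0// => r.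
  by apply/andP => -[phir /eqP rA]; rewrite -rA phir in phiA.
rewrite (eq_bigl (fun r => survivors k r == A)) => [|r].
  rewrite prob_survivors// mulrCA divff ?mulr1 ?mulrb//.
  by rewrite pnatr_eq0 -lt0n bin_gt0.
by have [->|] := eqVneq (survivors k r) A; rewrite ?phiA ?andbF.
Qed.

End Boland.

(** * Taylor expansion of the reflected diagonal section about 1 *)

Theorem theorem5 (R : realType) (n : nat) (phi : structure_function n)
    (d : measure_display) (Omega : measurableType d) (P : probability Omega R)
    (T : 'I_n -> {RV P >-> R})
    (hphi : semicoherent phi)
    (hind : independent_RVs T)
    (hid : identically_distributed T)
    (hcont : continuously_distributed T) :
  let h : {poly R} := diagonal_section phi in
  let hR : {poly R} := reflected_poly n h in
  hR = \sum_(0 <= k < n.+1)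
         ('C(n, k)%:R * tail_signature phi T k) *: ('X - 1%:P) ^+ k
  /\ (forall k : nat, (k <= n)%N ->
        (hR^`(k)).[1] / (k`!)%:R = 'C(n, k)%:R * tail_signature phi T k).
Proof.
move=> h hR.
have hRE : hR = \sum_(0 <= k < n.+1)
    ('C(n, k)%:R * tail_signature phi T k) *: ('X - 1%:P) ^+ k.
  rewrite /hR /h reflected_diagonal_section.
  rewrite (sum_scale_by_card phi (fun k => ('X - 1%:P) ^+ k)).
  by apply: eq_big_nat => k /andP[_ kn]; rewrite boland_formula.
split=> // k kn.
by rewrite hRE (taylor_coef_sum_exp (fun k => 'C(n, k)%:R * tail_signature phi T k)).
Qed.
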